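(* Let $\mathcal{T}$ be a finite family of tiles in which all walls have size two, and let $\mathcal{G}$ be a family of cyclizations of finite sequences of tiles from $\mathcal{T}$. There exists an algorithm that, for each graph $G\in\mathcal{G}$ (given as the cyclization of a sequence of tiles from $\mathcal{T}$), outputs the number of distinct Hamiltonian cycles in $G$, and whose running time is quadratic in the number of tiles (and hence in the number of vertices) of $G$.
   Context: A tile is a triple $T=(G,x,y)$ consisting of a graph $G$ and two sequences $x=(x_1,\dots,x_k)$ (left wall) and $y=(y_1,\dots,y_l)$ (right wall) of distinct vertices of $G$, with no vertex appearing in both $x$ and $y$; $|x|$ and $|y|$ are the wall sizes. Tiles $(G,x,y)$ and $(G',x',y')$ are compatible if $|y|=|x'|$; their join $(G,x,y)\otimes(G',x',y')$ is the tile whose graph is obtained from the disjoint union of $G$ and $G'$ by identifying $y$ term by term with $x'$, with left wall $x$ and right wall $y'$. The join of a compatible sequence $(T_0,\dots,T_m)$ is $T_0\otimes\cdots\otimes T_m$. For a tile $T=(G,x,y)$ with $|x|=|y|$, its cyclization $\circ T$ is the graph obtained from $G$ by identifying $x_j$ with $y_j$ for every $j$; the cyclization of a sequence of tiles whose join has equal-size walls is $\circ(T_0\otimes\cdots\otimes T_m)$. A Hamiltonian cycle is a cycle containing every vertex of the graph. *)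

(* Defs.v *)
From mathcomp Require Import all_boot.
Set Implicit Arguments.
Unset Strict Implicit.
Unset Printing Implicit Defensive.

(* Finite undirected multigraphs: loops and parallel edges are allowed, since
   identifying vertices can create them.  The order of the two ends of an edge
   carries no meaning; adjacency is only ever tested through [joins]. *)
Record mgraph := MGraph {
  vert : finType;
  edge : finType;
  ends : edge -> vert * vert
}.

Definition joins (G : mgraph) (e : edge G) (u v : vert G) : bool :=
  (ends e == (u, v)) || (ends e == (v, u)).

Definition isomorphic (G H : mgraph) : Prop :=
  exists (f : vert G -> vert H) (g : edge G -> edge H),
    [/\ bijective f, bijective g
      & forall e u v, joins (g e) (f u) (f v) = joins e u v].

(* The cycle v_0 e_0 v_1 e_1 ... v_(n-1) e_(n-1) v_0; distinctness of the edges
   only matters for n = 2, where it asks for two parallel edges. *)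
Definition traces_cycle (G : mgraph) (vs : seq (vert G)) (es : seq (edge G)) :=
  [&& 0 < size vs, uniq vs, uniq es
    & all2 (fun e (uv : vert G * vert G) => joins e uv.1 uv.2)
           es (zip vs (rot 1 vs))].

(* Cycles are subgraphs, hence determined by their edge sets: neither the
   starting point nor the direction of a traversal counts.  A Hamiltonian cycle
   has exactly #|vert G| vertices, which bounds the two existentials. *)
Definition hamiltonian_cycle (G : mgraph) (C : {set edge G}) : bool :=
  [exists vs : #|vert G|.-tuple (vert G),
   exists es : #|vert G|.-tuple (edge G),
    [&& traces_cycle vs es, [forall v, v \in vs] & C == [set e in es]]].

Definition num_hamiltonian_cycles (G : mgraph) : nat :=
  #|[set C : {set edge G} | hamiltonian_cycle C]|.

Definition disjoint_union (G H : mgraph) : mgraph :=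
  @MGraph (vert G + vert H)%type (edge G + edge H)%type
    (fun e => match e with
              | inl a => (inl (ends a).1, inl (ends a).2)
              | inr b => (inr (ends b).1, inr (ends b).2)
              end).

Definition glue_rel (V : finType) k (a b : k.-tuple V) : rel V :=
  fun u v => [exists j, ((u, v) == (tnth a j, tnth b j))
                     || ((v, u) == (tnth a j, tnth b j))].

Lemma glue_connect_sym (V : finType) k (a b : k.-tuple V) :
  connect_sym (glue_rel a b).
Proof.
apply: sym_connect_sym => u v.
by apply: eq_existsb => j; rewrite orbC.
Qed.

(* The classes of the equivalence relation generated by a_j ~ b_j, each
   represented by its canonical element. *)
Definition glue_vert (V : finType) k (a b : k.-tuple V) : finType :=
  {v : V | roots (glue_rel a b) v}.

Definition glue_class (V : finType) k (a b : k.-tuple V) (v : V) :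
    glue_vert a b :=
  exist _ (root (glue_rel a b) v) (roots_root (glue_connect_sym a b) v).

(* Identification of a with b term by term; every edge survives. *)
Definition identify (G : mgraph) k (a b : k.-tuple (vert G)) : mgraph :=
  @MGraph (glue_vert a b) (edge G)
    (fun e => (glue_class a b (ends e).1, glue_class a b (ends e).2)).

(* A vertex outside a and b forms a class on its own. *)
Lemma glue_class_inj (V : finType) k (a b : k.-tuple V) (u v : V) :
  u \notin a -> u \notin b -> glue_class a b u = glue_class a b v -> u = v.
Proof.
move=> ua ub /(congr1 val) /= /eqP.
rewrite (root_connect (glue_connect_sym a b)) => /connectP[[|w p] //= /andP[H _] _].
case/existsP: H => j /orP[] /eqP[uE wE].
  by rewrite uE mem_tnth in ua.
by rewrite wE mem_tnth in ub.
Qed.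

(* Compatibility of tiles is carried by the types: the wall sizes are the two
   indices. *)
Record tile (k l : nat) := Tile {
  tile_graph :> mgraph;
  lwall : k.-tuple (vert tile_graph);
  rwall : l.-tuple (vert tile_graph);
  walls_uniq : uniq (lwall ++ rwall)
}.

Definition join_graph k l m (S : tile k l) (T : tile l m) : mgraph :=
  @identify (disjoint_union S T) l
    (map_tuple inl (rwall S)) (map_tuple inr (lwall T)).

Definition join_class k l m (S : tile k l) (T : tile l m) :
    vert S + vert T -> vert (join_graph S T) :=
  @glue_class (vert S + vert T)%type l
    (map_tuple inl (rwall S)) (map_tuple inr (lwall T)).

Definition join_lwall k l m (S : tile k l) (T : tile l m) :
    k.-tuple (vert (join_graph S T)) :=
  map_tuple (fun v => join_class (inl v)) (lwall S).

Definition join_rwall k l m (S : tile k l) (T : tile l m) :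
    m.-tuple (vert (join_graph S T)) :=
  map_tuple (fun v => join_class (inr v)) (rwall T).

Lemma join_walls_uniq k l m (S : tile k l) (T : tile l m) :
  uniq (join_lwall S T ++ join_rwall S T).
Proof.
have inlP (V W : eqType) (s : seq V) (w : W) : inr w \notin map inl s.
  by apply/mapP => -[].
have inrP (V W : eqType) (s : seq W) (w : V) : inl w \notin map inr s.
  by apply/mapP => -[].
have := walls_uniq S; have := walls_uniq T; rewrite !cat_uniq.
move=> /and3P[_ /hasPn dT uT] /and3P[uS /hasPn dS _].
have SP v : v \in lwall S -> inl v \notin map_tuple (@inl _ (vert T)) (rwall S).
  move=> vl; rewrite mem_map => [|? ? []//].
  by apply/negP => /dS; rewrite /= vl.
have TP v : v \in rwall T -> inr v \notin map_tuple (@inr (vert S) _) (lwall T).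
  by move=> vr; rewrite mem_map => [|? ? []//]; apply: dT.
apply/and3P; split.
- rewrite map_inj_in_uniq // => u v uL _ E.
  by have [] := glue_class_inj (SP u uL) (inrP _ _ _ _) E.
- apply/hasPn => _ /mapP[v vR ->]; apply/mapP => -[u uL E].
  by have := glue_class_inj (inlP _ _ _ _) (TP v vR) E.
- rewrite map_inj_in_uniq // => u v uR _ E.
  by have [] := glue_class_inj (inlP _ _ _ _) (TP u uR) E.
Qed.

Definition join k l m (S : tile k l) (T : tile l m) : tile k m :=
  Tile (join_walls_uniq S T).

Definition cyclization k (T : tile k k) : mgraph :=
  identify (lwall T) (rwall T).

(* T_0 (x) T_1 (x) ... (x) T_m, bracketed to the left. *)
Definition join_seq k (T0 : tile k k) (Ts : seq (tile k k)) : tile k k :=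
  foldl (@join k k k) T0 Ts.

(* Deterministic multitape Turing machines over the input alphabet A.  There
   are ntapes.+1 two-way infinite tapes; the tape alphabet consists of a blank,
   the input symbols, the two binary digits and finitely many work symbols. *)
Definition tape_symbol (A W : finType) : finType := option (A + bool + W)%type.

Inductive move := MoveLeft | Stay | MoveRight.

Record machine (A : finType) := Machine {
  ntapes : nat;
  state : finType;
  work : finType;
  start : state;
  (* [None] means that the machine halts. *)
  trans : state -> {ffun 'I_ntapes.+1 -> tape_symbol A work} ->
          option (state * {ffun 'I_ntapes.+1 -> tape_symbol A work * move})
}.

(* [Tape l a r]: the head scans a, r is the content to its right and l the
   content to its left, nearest cell first in both; all other cells are blank. *)
Record tape (X : Type) := Tape { tleft : seq X; scanned : X; tright : seq X }.

Definition tape_of (X : Type) (blank : X) (w : seq X) : tape X :=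
  Tape [::] (head blank w) (behead w).

Definition update_tape (X : Type) (blank : X) (t : tape X) (am : X * move) :
    tape X :=
  let (a, d) := am in
  match d with
  | MoveLeft => Tape (behead (tleft t)) (head blank (tleft t)) (a :: tright t)
  | Stay => Tape (tleft t) a (tright t)
  | MoveRight => Tape (a :: tleft t) (head blank (tright t)) (behead (tright t))
  end.

Record config (A : finType) (M : machine A) := Config {
  cstate : state M;
  tapes : {ffun 'I_(ntapes M).+1 -> tape (tape_symbol A (work M))}
}.

Definition next_action (A : finType) (M : machine A) (c : config M) :=
  trans (cstate c) [ffun i => scanned (tapes c i)].

Definition halted (A : finType) (M : machine A) (c : config M) : bool :=
  ~~ isSome (next_action c).

Definition step (A : finType) (M : machine A) (c : config M) : config M :=
  if next_action c is Some (q, act) then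
    Config q [ffun i => update_tape None (tapes c i) (act i)]
  else c.

(* The input is written on the first tape, with the head on its first symbol;
   the other tapes are blank. *)
Definition init (A : finType) (M : machine A) (w : seq A) : config M :=
  Config (start M)
    [ffun i : 'I_(ntapes M).+1 =>
       tape_of None (if i == ord0 then [seq Some (inl (inl a)) | a <- w]
                     else [::])].

Fixpoint read_bits (A W : finType) (s : seq (tape_symbol A W)) : seq bool :=
  if s is Some (inl (inr b)) :: s' then b :: read_bits s' else [::].

Definition nat_of_bits (bs : seq bool) : nat :=
  foldr (fun (b : bool) n => b + n.*2) 0 bs.

(* The output is the number written in binary on the last tape, least
   significant digit first, from the head up to the first non-digit. *)
Definition output (A : finType) (M : machine A) (c : config M) : nat :=
  let t := tapes c ord_max in nat_of_bits (read_bits (scanned t :: tright t)).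

Definition outputs_within (A : finType) (M : machine A) (w : seq A)
    (t n : nat) : Prop :=
  let c := iter t (@step A M) (init M w) in halted c /\ output c = n.

(* Main.v *)
Require Import Defs.
From mathcomp Require Import all_boot.
From mathcomp Require Import zify.
Set Implicit Arguments.
Unset Strict Implicit.
Unset Printing Implicit Defensive.

(* A Hamiltonian cycle is a spanning edge set that is 2-regular and connected;
   connected means that exactly two 0/1-colourings of the vertices are constant
   along its edges.  For an edge set of a tile, record the degrees of the wall
   vertices, whether all other vertices have degree 2, and, for each colouring
   of the walls, the number of its invariant extensions.  With numbers capped
   at 3 this takes finitely many values, the value for a join is a function of
   the values for the two factors, and it decides whether the cyclization is
   Hamiltonian.  Hence the vector counting edge sets by value is multiplied by
   a fixed matrix for each tile.  Its entries have O(n) binary digits, so each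
   multiplication is one linear-time sweep over the vector. *)

(** * Linear recurrences on a Turing machine *)

Section LinearMachine.
(** The input symbol [i] that comes first selects the initial vector [u i]. Each later symbol [i]
    applies the matrix [A (Some i)], the blank after the input applies the closing matrix [A None],
    and entry [j0] of the result is the output. *)
Variables (I J : finType) (j0 : J) (B : nat).
Variables (u : I -> J -> nat) (A : option I -> J -> J -> nat).
Hypothesis u_le : forall i j, u i j <= B.
Hypothesis A_le : forall o j, \sum_k A o j k <= B.

Definition apply_mx (o : option I) (x : {ffun J -> nat}) : {ffun J -> nat} :=
  [ffun j => \sum_k A o j k * x k].

Local Notation bits := {ffun J -> bool}.
Local Notation carry := {ffun J -> 'I_B.+1}.
Local Notation symbol := (tape_symbol I bits).

Definition value (ws : seq bits) : {ffun J -> nat} :=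
  [ffun j => nat_of_bits [seq (d : bits) j | d <- ws]].

Definition no_carry : carry := [ffun => ord0].

Definition digit_sum o (c : carry) (d : bits) (j : J) : nat :=
  \sum_k A o j k * d k + c j.

Definition next_carry o c d : carry := [ffun j => inord (digit_sum o c d j)./2].

Definition next_digit o c d : bits := [ffun j => odd (digit_sum o c d j)].

(** A row sum of at most [B] plus a carry of at most [B] halves to at most [B], so [inord] does not
    truncate and finitely many carries suffice. *)
Lemma next_carryE o c d j : next_carry o c d j = (digit_sum o c d j)./2 :> nat.
Proof.
rewrite ffunE inordK //.
have: \sum_k A o j k * d k <= B.
  by apply: leq_trans (A_le o j); apply: leq_sum => k _; case: (d k); lia.
rewrite /digit_sum; have := ltn_ord (c j); lia.
Qed.

Lemma value_nil j : value [::] j = 0.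
Proof. by rewrite ffunE. Qed.

Lemma value_cons d ws j : value (d :: ws) j = d j + (value ws j).*2.
Proof. by rewrite !ffunE. Qed.

(* The vector is stored on the second tape, one vector of bits per cell, least
   significant first.  [Sweep c] multiplies it in place by the matrix of the
   scanned input symbol, with carry vector [c]; [Rewind] returns to the blank
   before the first cell and advances the input head. *)
Definition mstate : finType := (bool + option carry)%type.
Local Notation Start := (inl true : mstate).
Local Notation Halt := (inl false : mstate).
Local Notation Rewind := (inr None : mstate).
Local Notation Sweep c := (inr (Some c) : mstate).

Definition input_of (a : symbol) : option I :=
  if a is Some (inl (inl i)) then Some i else None.

Definition bits_of (a : symbol) : bits :=
  if a is Some (inr d) then d else [ffun => false].

(* The last sweep, on the blank after the input, leaves plain binary digits. *)
Definition write_bits (o : option I) (d : bits) : symbol :=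
  if o is Some _ then Some (inr d) else Some (inl (inr (d j0))).

(** The initial vector is loaded as the carry of a first sweep over an empty number: the matrix of
    the first symbol multiplies zero, and only the carry gets written. *)
Definition delta (q : mstate) (o : option I) (a : symbol) :
    option (mstate * (move * (symbol * move))) :=
  match q with
  | inl true => if o is Some i then
               Some (Sweep [ffun j => inord (u i j)], (Stay, (a, Stay)))
             else None
  | inl false => None
  | inr (Some c) => if (a == None) && (c == no_carry) then
                 Some (Rewind, (Stay, (a, MoveLeft)))
               else let d := bits_of a in
                 Some (Sweep (next_carry o c d),
                       (Stay, (write_bits o (next_digit o c d), MoveRight)))
  | inr None => if a == None then
                Some (if o is Some _ then Sweep no_carry else Halt,
                      (MoveRight, (a, MoveRight)))
              else Some (Rewind, (Stay, (a, MoveLeft)))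
  end.

Definition lin_machine : machine I :=
  @Machine I 1 mstate bits Start (fun q r =>
    omap (fun p => (p.1, [ffun k => if k == ord0 then (r ord0, p.2.1) else p.2.2]))
         (delta q (input_of (r ord0)) (r ord_max))).

Definition conf q t0 t1 : config lin_machine :=
  @Config I lin_machine q [ffun k => if k == ord0 then t0 else t1].

Local Notation stepM := (@step I lin_machine).

Lemma step_conf q t0 t1 q' m0 am :
  delta q (input_of (scanned t0)) (scanned t1) = Some (q', (m0, am)) ->
  stepM (conf q t0 t1) =
  conf q' (update_tape None t0 (scanned t0, m0)) (update_tape None t1 am).
Proof.
move=> E; rewrite /step /next_action /= !ffunE /= E /=; congr Config.
by apply/ffunP => k; rewrite !ffunE; case: ifP.
Qed.

Lemma output_conf q t0 t1 :
  output (conf q t0 t1) = nat_of_bits (read_bits (scanned t1 :: tright t1)).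
Proof. by rewrite /output ffunE. Qed.

Lemma update_stay (X : Type) (blank : X) t : update_tape blank t (scanned t, Stay) = t.
Proof. by case: t. Qed.

Definition tape_at (X : Type) (blank : X) (l w : seq X) : tape X :=
  Tape l (head blank w) (behead w).

(** * Passes over the stored vector *)

Lemma sweep_carry b (c : carry) t0 l m :
    (forall j, c j <= b) ->
  exists ws m',
    [/\ iter (size ws) stepM (conf (Sweep c) t0 (tape_at None l (nseq m None)))
        = conf (Sweep no_carry) t0
            (tape_at None (catrev (map (write_bits (input_of (scanned t0))) ws) l)
               (nseq m' None)),
        size ws <= b & forall j, value ws j = c j].
Proof.
have head_nseq n : head (None : symbol) (nseq n None) = None by case: n.
have sum0 o (c' : carry) j :
    digit_sum o c' (bits_of (None : symbol)) j = c' j.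
  by rewrite /digit_sum big1 // => k _; rewrite ffunE muln0.
elim: b c l m => [|b IH] c l m cb.
  have -> : c = no_carry.
    by apply/ffunP => j; apply/val_inj; have := cb j; rewrite ffunE /=; lia.
  by exists [::], m; split=> // j; rewrite value_nil ffunE.
have [->|cN] := eqVneq c no_carry.
  by exists [::], m; split=> // j; rewrite value_nil ffunE.
set o := input_of _; set d := bits_of (None : symbol).
have [|ws [m' [E sz vE]]] :=
    IH (next_carry o c d) (write_bits o (next_digit o c d) :: l) m.-1.
  by move=> j; rewrite next_carryE sum0; have := cb j; lia.
exists (next_digit o c d :: ws), m'; split=> //=.
- rewrite -iterS iterSr -E; congr (iter _ _ _).
  rewrite (@step_conf _ _ _ (Sweep (next_carry o c d)) Stay
     (write_bits o (next_digit o c d), MoveRight)); last first.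
    by rewrite /= head_nseq /= (negPf cN).
  by rewrite update_stay; case: m {E IH}.
- by move=> j; rewrite value_cons vE next_carryE ffunE sum0 odd_double_half.
Qed.

(** This is long multiplication: writing the parity of each digit sum and carrying its half
    preserves the total. Beyond the last digit only the carry is left; halving clears it within [B]
    steps, which bounds the growth of the number. The lists [nseq m None] are blank cells that the
    head has already visited. *)
Lemma sweep_bits ws (c : carry) t0 l m :
  let o := input_of (scanned t0) in
  exists ws' m',
    [/\ iter (size ws') stepM
          (conf (Sweep c) t0
             (tape_at None l ([seq Some (inr d) | d <- ws] ++ nseq m None)))
        = conf (Sweep no_carry) t0
            (tape_at None (catrev (map (write_bits o) ws') l) (nseq m' None)),
        size ws' <= size ws + B
      & forall j, value ws' j = apply_mx o (value ws) j + c j].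
Proof.
move=> o; elim: ws c l => [|d ws IH] c l.
  have [|ws' [m' [E sz vE]]] := @sweep_carry B c t0 l m.
    by move=> j; rewrite -ltnS.
  exists ws', m'; split=> // j; rewrite vE ffunE big1 // => k _.
  by rewrite value_nil muln0.
have [ws' [m' [E sz vE]]] := IH (next_carry o c d) (write_bits o (next_digit o c d) :: l).
exists (next_digit o c d :: ws'), m'; split=> //=.
- rewrite -iterS iterSr -E; congr (iter _ _ _).
  rewrite (@step_conf _ _ _ (Sweep (next_carry o c d)) Stay
     (write_bits o (next_digit o c d), MoveRight)) //.
  by rewrite update_stay.
- move=> j; rewrite value_cons vE next_carryE ffunE !ffunE.
  under [in RHS]eq_bigr => k _ do rewrite value_cons mulnDr -doubleMr.
  rewrite big_split /=.
  have := odd_double_half (digit_sum o c d j); rewrite {3}/digit_sum.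
  have -> : \sum_i (A o j i * value ws i).*2 = (\sum_i A o j i * value ws i).*2.
    by rewrite -mul2n big_distrr /=; apply: eq_bigr => i _; rewrite mul2n.
  lia.
Qed.

(** Here [ys] lists the stored cells leftwards from the head, so [catrev ys r] restores their order.
    Each cell costs one step, and one more step turns round at the blank before them. *)
Lemma rewind_bits ys t0 k r :
    None \notin ys ->
  iter (size ys).+1 stepM (conf Rewind t0
    (Tape (behead (ys ++ nseq k None)) (head None (ys ++ nseq k None)) r))
  = conf (if input_of (scanned t0) is Some _ then Sweep no_carry else Halt)
      (update_tape None t0 (scanned t0, MoveRight))
      (tape_at None (None :: nseq k.-1 None) (catrev ys r)).
Proof.
elim: ys r => [|y ys IH] r.
  move=> _ /=; rewrite (@step_conf _ _ _
    (if input_of (scanned t0) is Some _ then Sweep no_carry else Halt)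
    MoveRight (None, MoveRight)) //=; case: k => //=.
rewrite inE negb_or => /andP[yN ysN].
rewrite [size _]/= iterSr (@step_conf _ _ _ Rewind Stay (y, MoveLeft)); last first.
  by rewrite /= eq_sym (negPf yN).
by rewrite update_stay -IH.
Qed.

Lemma one_pass ws (c : carry) t0 k m :
  let o := input_of (scanned t0) in
  exists ws' k' m',
    [/\ iter (2 * size ws' + 2) stepM
          (conf (Sweep c) t0
             (tape_at None (nseq k None)
                ([seq Some (inr d) | d <- ws] ++ nseq m None)))
        = conf (if o is Some _ then Sweep no_carry else Halt)
            (update_tape None t0 (scanned t0, MoveRight))
            (tape_at None (nseq k' None) (map (write_bits o) ws' ++ nseq m' None)),
        size ws' <= size ws + B
      & forall j, value ws' j = apply_mx o (value ws) j + c j].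
Proof.
move=> o; have [ws' [m' [E sz vE]]] := sweep_bits ws c t0 (nseq k None) m.
(* The head visits a blank at both ends, so at least one is recorded on each side. The steps are
   [size ws'] for the sweep, one to turn at the right end, and [(size ws').+1] for the rewind. *)
exists ws', k.-1.+1, m'.-1.+1; split=> //.
rewrite (_ : 2 * _ + 2 = (size ws').+1 + (1 + size ws')); last by lia.
rewrite !iterD {}E /= (@step_conf _ _ _ Rewind Stay (None, MoveLeft)); last first.
  by case: m'; rewrite /= eqxx.
rewrite -iterS -(size_map (write_bits o)) -size_rev -/o catrevE.
rewrite update_stay rewind_bits; last first.
  by rewrite mem_rev; apply/mapP => -[d _]; rewrite /write_bits; case: o.
by rewrite catrevE revK; case: m' {vE sz}.
Qed.

(** The first symbol of [s] is the one whose pass is beginning, and [x] is the vector that this pass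
    leaves; for empty [s] it is the closing pass. There are [(size s).+1] passes, and each lengthens
    the number by at most [B] cells. *)
Lemma all_passes s ws (c : carry) l k m :
  let x := [ffun j => apply_mx (ohead s) (value ws) j + c j] in
  exists t, let cf := iter t stepM (conf (Sweep c)
    (tape_at None l [seq Some (inl (inl i)) | i <- s])
    (tape_at None (nseq k None) ([seq Some (inr d) | d <- ws] ++ nseq m None))) in
  [/\ halted cf,
      output cf = (if s is i :: s' then apply_mx None
        (foldl (fun y i => apply_mx (Some i) y) x s') else x) j0
    & t <= (size s).+1 * (2 * (size ws + (size s).+1 * B) + 2)].
Proof.
have arith t' a b n : t' <= n.+1 * (2 * (a + n.+1 * B) + 2) -> a <= b + B ->
  t' + (2 * a + 2) <= n.+2 * (2 * (b + n.+2 * B) + 2) by nia.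
elim: s ws c l k m => [|i s IH] ws c l k m x.
  have [ws' [k' [m' [E sz vE]]]] := one_pass ws c (tape_at None l [::]) k m.
  exists (2 * size ws' + 2); rewrite [map _ [::]]/= E.
  split; last by rewrite !mul1n leq_add2r leq_mul2l.
  - exact: isT.
  (* The closing pass wrote plain binary digits, which [read_bits] collects up to the first
     blank. *)
  rewrite output_conf ffunE -vE ffunE; congr nat_of_bits.
  case: ws' {E sz vE} => [|d ws1] /=; first by case: m'.
  by congr (_ :: _); elim: ws1 => [|d1 ws1 IHw] /=; [case: m' | rewrite IHw].
have [ws' [k' [m' [E sz vE]]]] :=
  one_pass ws c (tape_at None l [seq Some (inl (inl i)) | i <- i :: s]) k m.
have {IH} := IH ws' no_carry (Some (inl (inl i)) :: l) k' m'.
move=> [t [Ht Et lt]]; exists (t + (2 * size ws' + 2)); rewrite iterD E; split.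
- exact: Ht.
- rewrite [LHS]Et; have -> : x = value ws' by apply/ffunP => j; rewrite ffunE -vE.
  have -> : [ffun j => apply_mx (ohead s) (value ws') j + no_carry j]
            = apply_mx (ohead s) (value ws').
    by apply/ffunP => j; rewrite ffunE [no_carry _]ffunE addn0.
  by case: (s).
exact: arith lt sz.
Qed.

Lemma lin_machine_correct i s :
  exists t,
    outputs_within lin_machine (i :: s) t
      (apply_mx None
         (foldl (fun y i => apply_mx (Some i) y) (finfun (u i)) s) j0) /\
    t <= (8 * B + 5) * (size (i :: s)) ^ 2.
Proof.
have [t] := all_passes (i :: s) [::] [ffun j => inord (u i j)] [::] 0 0.
move=> [Ht Et lt]; exists (t + 1).
have initE : stepM (init lin_machine (i :: s)) =
    conf (Sweep [ffun j => inord (u i j)])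
      (tape_at None [::] [seq Some (inl (inl i)) | i <- i :: s])
      (tape_at None (nseq 0 None) ([seq Some (inr d) | d <- [::]] ++ nseq 0 None)).
  rewrite (_ : init _ _ = conf Start (tape_of None [seq Some (inl (inl i)) | i <- i :: s])
    (tape_of None [::])); last first.
    by congr Config; apply/ffunP => k; rewrite !ffunE; case: ifP.
  by rewrite (@step_conf _ _ _ (Sweep [ffun j => inord (u i j)]) Stay (None, Stay)).
(* For input length [n] the bound is [n.+1 * (2 * (n.+1 * B) + 2) + 1], the last summand being the
   start step. Since [n] is positive, [n.+1 <= 2 * n] yields [8 * B], and [2 * n + 3 <= 5 * n ^ 2]
   yields [5]. *)
split; last by rewrite /= in lt *; nia.
rewrite /outputs_within iterD [iter 1 _ _]/= initE; split; first exact: Ht.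
rewrite [LHS]Et; congr (apply_mx _ (foldl _ _ _) _); apply/ffunP => j.
rewrite !ffunE big1 => [|k _]; last by rewrite value_nil muln0.
by rewrite add0n inordK // ltnS.
Qed.

End LinearMachine.

(** * Hamiltonian cycles as connected 2-regular spanning subgraphs *)

Lemma cycle_map_rot1 (T : eqType) (f : T -> T) (s : seq T) :
  fcycle f s -> map f s = rot 1 s.
Proof.
case: s => //= x p; rewrite rot1_cons.
have pathE z y : path (frel f) z (rcons p y) -> f z :: map f p = rcons p y.
  elim: p z => [|w p IH] z /=; first by rewrite andbT => /eqP->.
  by move=> /andP[/eqP-> /IH->].
exact: pathE.
Qed.

Lemma uniq_map_inj_in (T U : eqType) (f : T -> U) (s : seq T) :
  uniq (map f s) -> {in s &, injective f}.
Proof.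
elim: s => //= x s IH /andP[xs us] y z; rewrite !inE.
move=> /orP[/eqP->|ys] /orP[/eqP->|zs] // E; last exact: IH.
  by rewrite E map_f in xs.
by rewrite -E map_f in xs.
Qed.

Lemma rot1_fixed_constant (T : eqType) (x : T) (p : seq T) :
  rcons p x = x :: p -> all (pred1 x) p.
Proof. by elim: p => //= y p IH [->] /IH ->; rewrite eqxx. Qed.

Section Darts.
Variable G : mgraph.
Implicit Types (C : {set edge G}) (v : vert G) (d : edge G * bool).

(** A pair [(e, b)] is a dart: the edge [e] with a direction, leaving from its tail. A loop has two
    darts at its vertex and so counts twice in [deg]. *)
Definition tail d : vert G := if d.2 then (ends d.1).2 else (ends d.1).1.

Definition flip d : edge G * bool := (d.1, ~~ d.2).

Definition deg C v := #|[set d | (d.1 \in C) && (tail d == v)]|.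

Definition edge_invariant C (h : vert G -> bool) :=
  [forall (e | e \in C), h (ends e).1 == h (ends e).2].

Definition num_colourings C := #|[set h : {ffun vert G -> bool} | edge_invariant C h]|.

Lemma flipK : involutive flip.
Proof. by case=> e b; rewrite /flip negbK. Qed.

Lemma flip_neq d : flip d != d.
Proof. by case: d => e []; rewrite xpair_eqE andbF. Qed.

Lemma same_edge d d' : d.1 = d'.1 -> d' = d \/ d' = flip d.
Proof.
by case: d d' => [e b] [_ b'] /= <-; case: b b' => [] []; [left|right|right|left].
Qed.

Lemma joinsP e u v :
  reflect (exists b, tail (e, b) = u /\ tail (flip (e, b)) = v) (joins e u v).
Proof.
rewrite /joins; case E: (ends e) => [x y]; rewrite !xpair_eqE.
apply: (iffP orP) => [[] /andP[/eqP xE /eqP yE]|[[]]].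
- by exists false; rewrite /tail /= E.
- by exists true; rewrite /tail /= E.
- by rewrite /tail /= E /= => -[-> ->]; rewrite !eqxx; right.
- by rewrite /tail /= E /= => -[-> ->]; rewrite !eqxx; left.
Qed.

Lemma edge_invariantP C (h : vert G -> bool) :
  reflect (forall d, d.1 \in C -> h (tail d) = h (tail (flip d))) (edge_invariant C h).
Proof.
apply: (iffP forall_inP) => [H [e b] /= /H/eqP|H e eC]; first by case: b.
by apply/eqP/(H (e, false)).
Qed.

(** The two constant colourings are always invariant, and they differ because a vertex [x0] exists;
    the count is 2 exactly when there are no others. *)
Lemma num_colourings2P C (x0 : vert G) :
  reflect (forall h, edge_invariant C h -> forall u v, h u = h v) (num_colourings C == 2).
Proof.
have cst (b : bool) : [ffun => b] \in [set h : {ffun vert G -> bool} | edge_invariant C h].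
  by rewrite inE; apply/edge_invariantP => d _; rewrite !ffunE.
have ne : [ffun => true] != [ffun => false] :> {ffun vert G -> bool}.
  by apply/eqP => /ffunP/(_ x0); rewrite !ffunE.
have sub : [set [ffun => true]; [ffun => false]] \subset
    [set h : {ffun vert G -> bool} | edge_invariant C h].
  by rewrite subUset !sub1set !cst.
have card2 : #|[set [ffun => true]; [ffun => false] : {ffun vert G -> bool}]| = 2.
  by rewrite cards2 ne.
apply: (iffP eqP) => [n2 h hI u v|H].
  have /eqP E : [set [ffun => true]; [ffun => false]] ==
      [set h : {ffun vert G -> bool} | edge_invariant C h].
    by rewrite eqEcard sub card2 -n2 leqnn.
  have : finfun h \in [set h : {ffun vert G -> bool} | edge_invariant C h].
    by rewrite inE; apply/edge_invariantP => d dC; rewrite !ffunE;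
    apply: (edge_invariantP _ _ hI).
  by rewrite -E !inE => /orP[] /eqP/ffunP hE; have := hE u; have := hE v;
    rewrite !ffunE => -> ->.
rewrite /num_colourings -card2; apply/eqP; rewrite eqn_leq (subset_leq_card sub) andbT.
apply/subset_leq_card/subsetP => h; rewrite !inE => /H hC.
case E : (h x0); apply/orP; [left|right]; apply/eqP/ffunP => v;
  by rewrite ffunE -E; apply: hC.
Qed.

Lemma hamiltonian_cycleP C :
  reflect (exists vs es, [/\ traces_cycle vs es, forall v, v \in vs & C = [set e in es]])
          (hamiltonian_cycle C).
Proof.
apply: (iffP existsP) => [[vs /existsP[es /and3P[tr /forallP vsP /eqP ->]]]|].
  by exists vs, es.
move=> [vs [es [tr vsP CE]]]; have /and4P[_ uvs _] := tr.
rewrite all2E => /andP[/eqP sz _].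
have svs : size vs == #|vert G|.
  by rewrite -(card_uniqP uvs); apply/eqP/eq_card => v; rewrite vsP.
have ses : size es == #|vert G| by rewrite sz size_zip size_rot minnn.
exists (Tuple svs); apply/existsP; exists (Tuple ses).
by rewrite /= tr CE eqxx andbT; apply/forallP => v; apply: vsP.
Qed.

Lemma orient_closed_walk (es : seq (edge G)) (uvs : seq (vert G * vert G)) :
  all2 (fun e (uv : vert G * vert G) => joins e uv.1 uv.2) es uvs ->
  exists2 ds, map fst ds = es & [seq (tail d, tail (flip d)) | d <- ds] = uvs.
Proof.
elim: es uvs => [|e es IH] [|[u v] uvs] //=; first by exists [::].
move=> /andP[/joinsP[b [ub vb]] /IH[ds dsE dsU]].
by exists ((e, b) :: ds); rewrite /= ?dsE ?dsU ?ub ?vb.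
Qed.

(** Directing the edges along the traversal gives darts [ds], and the darts of [C] are these and
    their flips. Every vertex is the tail of exactly one dart of each kind. An invariant colouring,
    read along the cycle, is fixed by rotation and hence constant. *)
Lemma hamiltonian_cycle_connected_2regular (x0 : vert G) C :
  hamiltonian_cycle C -> [forall v, deg C v == 2] && (num_colourings C == 2).
Proof.
move=> /hamiltonian_cycleP[vs [es [/and4P[_ uvs ues walk] vsP CE]]].
have [ds dsE dsU] := orient_closed_walk walk.
have tailE : map tail ds = vs.
  have := congr1 unzip1 dsU; rewrite unzip1_zip ?size_rot // => <-.
  by rewrite /unzip1 -map_comp.
have headE : map (tail \o flip) ds = rot 1 vs.
  have := congr1 unzip2 dsU; rewrite unzip2_zip ?size_rot // => <-.
  by rewrite /unzip2 -map_comp.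
have uds : uniq ds by apply: (@map_uniq _ _ fst); rewrite dsE.
have fst_inj : {in ds &, injective fst}.
  by apply: uniq_map_inj_in; rewrite dsE.
apply/andP; split.
  apply/forallP => v; apply/eqP.
  have uall : uniq (ds ++ map flip ds).
    rewrite cat_uniq uds (map_inj_uniq (can_inj flipK)) uds andbT /=.
    apply/hasPn => _ /mapP[d dD ->]; apply/negP => /= fD.
    by have /eqP := fst_inj _ _ fD dD erefl; rewrite (negPf (flip_neq d)).
  have -> : deg C v = #|[seq d <- ds ++ map flip ds | tail d == v]|.
    apply: eq_card => d; rewrite inE mem_filter andbC; congr (_ && _).
    rewrite CE inE -dsE mem_cat; apply/mapP/orP => [[d' d'D dE]|[dD|/mapP[d' d'D ->]]].
    - have [->|->] := same_edge (esym dE); first by left.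
      by right; apply: map_f.
    - by exists d.
    - by exists d'.
  have := filter_uniq (fun d => tail d == v) uall; move/card_uniqP => ->.
  rewrite size_filter count_cat count_map.
  have -> : count (fun d => tail d == v) ds = count_mem v vs by rewrite -tailE count_map.
  have -> : count (preim flip (fun d => tail d == v)) ds = count_mem v (rot 1 vs).
    by rewrite -headE count_map.
  by rewrite !count_uniq_mem ?rot_uniq ?mem_rot ?vsP.
apply/(num_colourings2P C x0) => h hI.
have: rot 1 (map h vs) = map h vs.
  rewrite -map_rot -headE -tailE -!map_comp; apply/eq_in_map => d dD /=.
  by rewrite -(edge_invariantP _ _ hI) // CE inE -dsE map_f.
case E: vs => [|w ws]; first by have := vsP x0; rewrite E.
rewrite rot1_cons => /rot1_fixed_constant/allP hC.
have hw v : h v = h w.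
  by have := vsP v; rewrite E inE => /orP[/eqP->//|vw]; apply/eqP/hC/map_f.
by move=> u v; rewrite !hw.
Qed.

(** * The closed walk in a 2-regular edge set *)

Section Walk.
Variable C : {set edge G}.
Hypothesis deg2 : forall v, deg C v = 2.

(** The default [d] makes this the identity outside [C], so that it is an involution on all
    darts. *)
Definition other d :=
  odflt d [pick d' | [&& d.1 \in C, d' != d, d'.1 \in C & tail d' == tail d]].

Lemma otherP d : d.1 \in C ->
  [/\ other d != d, (other d).1 \in C, tail (other d) = tail d
    & forall d', d'.1 \in C -> tail d' = tail d -> d' = d \/ d' = other d].
Proof.
move=> dC; have /eqP/cards2P[a [b [ab E]]] := deg2 (tail d).
have inE2 d' : (d'.1 \in C) && (tail d' == tail d) = (d' == a) || (d' == b).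
  by move/setP/(_ d'): E; rewrite !inE.
have [c cd cE] : exists2 c, c != d & forall d',
    (d'.1 \in C) && (tail d' == tail d) = (d' == d) || (d' == c).
  have := inE2 d; rewrite dC eqxx => /esym/orP[] /eqP dE.
    by exists b => [|d']; rewrite ?inE2 dE // eq_sym.
  by exists a => [|d']; rewrite ?inE2 dE // orbC.
have oE : other d = c.
  rewrite /other; case: pickP => [d' /and4P[_ d'd d'C /eqP td]|/(_ c)] /=.
    by have := cE d'; rewrite d'C td eqxx (negPf d'd) => /esym/eqP.
  by rewrite dC cd /=; have := cE c; rewrite eqxx orbT => ->.
have := cE c; rewrite eqxx orbT oE => /andP[cC /eqP tc]; split=> // d' d'C td.
by have := cE d'; rewrite d'C td eqxx => /esym/orP[] /eqP; [left|right].
Qed.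

Lemma otherK : involutive other.
Proof.
move=> d; case dC: (d.1 \in C); last first.
  have oE : other d = d by rewrite /other; case: pickP => // d'; rewrite dC.
  by rewrite !oE.
have [od oC ot _] := otherP dC; have [ood _ _ ou] := otherP oC.
by have [dE|] := ou d dC (esym ot); first by rewrite -dE eqxx in od.
Qed.

(** Crosses the edge of [d] and leaves the far end by the other dart there. As a composite of two
    involutions it permutes the darts. *)
Definition next d := other (flip d).

Lemma next_inj : injective next.
Proof. exact: inj_comp (can_inj otherK) (can_inj flipK). Qed.

Lemma next_in d : d.1 \in C -> (next d).1 \in C.
Proof. by move=> dC; have [] := @otherP (flip d) dC. Qed.

Lemma tail_next d : d.1 \in C -> tail (next d) = tail (flip d).
Proof. by move=> dC; have [] := @otherP (flip d) dC. Qed.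

(* The walk leaving a vertex never comes back through the other dart there:
   [other] reverses walks, so the middle of such a walk would be a fixed point
   of [other] or of [flip]. *)
Lemma iter_next_neq_other k d : d.1 \in C -> iter k next d != other d.
Proof.
elim/ltn_ind: k d => -[|[|k]] IH d dC.
- by have [ne _ _ _] := otherP dC; rewrite eq_sym.
- by rewrite (inj_eq (can_inj otherK)) flip_neq.
(* Cancelling the outermost [other] and [flip] leaves [iter k next (next d) = flip d], and [flip d]
   is [other (next d)], so the induction hypothesis applies to [next d]. *)
rewrite iterSr iterS (inj_eq (can_inj otherK)) -(inj_eq (can_inj flipK)) flipK.
by have := IH k (ltnW (ltnSn _)) _ (next_in dC); rewrite otherK.
Qed.

(** The orbit of a dart under [next] is the required traversal. The set of vertices it visits is
    closed along [C], so connectedness makes it everything; since the orbit never contains both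
    darts at a vertex, neither vertices nor edges repeat. *)
Lemma connected_2regular_hamiltonian (x0 : vert G) :
  num_colourings C == 2 -> hamiltonian_cycle C.
Proof.
move=> /(num_colourings2P C x0) conn.
have [d0] : exists d0, d0 \in [set d | (d.1 \in C) && (tail d == x0)].
  by apply/set0Pn; rewrite -card_gt0 -/(deg C x0) deg2.
rewrite inE => /andP[d0C /eqP d0x]; pose O := orbit next d0.
have memO d : d \in O -> d.1 \in C.
  rewrite -fconnect_orbit => /iter_findex <-.
  by elim: (findex _ _ _) => //= k /next_in.
have nextO : map next O = rot 1 O.
  by apply: cycle_map_rot1; apply: cycle_orbit next_inj d0.
have closedO d : d \in O -> next d \in O.
  by move=> dO; rewrite -(mem_rot 1) -nextO map_f.
have otherO d : d \in O -> other d \notin O.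
  move=> dO; apply/negP; have dC := memO d dO.
  rewrite -fconnect_orbit => c2; move: dO; rewrite -fconnect_orbit => c1.
  have: fconnect next d (other d).
    by apply: connect_trans c2; rewrite (fconnect_sym next_inj).
  by move=> /iter_findex/eqP; rewrite (negPf (iter_next_neq_other _ dC)).
(* Every edge of [C] at a visited vertex is traversed: the dart other than [next d''] there is
   [flip d''], by which the walk arrived. *)
have tailO d : d.1 \in C -> tail d \in map tail O -> (d \in O) || (flip d \in O).
  move=> dC /mapP[d' d'O td].
  have [_ _ _ /(_ d dC td)[->|->]] := otherP (memO d' d'O); first by rewrite d'O.
  move: d'O; rewrite -(mem_rot 1) -nextO => /mapP[d'' d''O ->].
  by rewrite otherK flipK d''O orbT.
have tail_flipO d : d.1 \in C -> tail d \in map tail O -> tail (flip d) \in map tail O.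
  move=> dC /(tailO _ dC)/orP[dO|fO]; last exact: map_f.
  by rewrite -tail_next //; apply/map_f/closedO.
have allO v : v \in map tail O.
  rewrite (conn (fun v => v \in map tail O) _ v x0).
    by rewrite -d0x map_f // -fconnect_orbit.
  apply/edge_invariantP => d dC; apply/idP/idP; first exact: tail_flipO.
  by rewrite -{2}(flipK d); apply: tail_flipO.
apply/hamiltonian_cycleP; exists (map tail O), (map fst O); split=> //.
  apply/and4P; split.
  - by rewrite size_map size_orbit order_gt0.
  - rewrite map_inj_in_uniq ?orbit_uniq // => d d' dO d'O td.
    have [_ _ _ /(_ d' (memO _ d'O) (esym td))[->//|d'E]] := otherP (memO d dO).
    by have := otherO d dO; rewrite -d'E d'O.
  (* If the orbit contained [d] and [flip d], it would also contain [next d], which is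
     [other (flip d)]. *)
  - rewrite map_inj_in_uniq ?orbit_uniq // => d d' dO d'O /same_edge[//|d'E].
    by have := otherO d' d'O; rewrite d'E (closedO d dO).
  rewrite -map_rot -nextO -map_comp all2E.
  rewrite size_map size_zip !size_map minnn eqxx /=.
  have -> : zip (map fst O) (zip (map tail O) (map (tail \o next) O)) =
      [seq (d.1, (tail d, tail (next d))) | d <- O].
    by elim: (O) => //= d s ->.
  rewrite all_map; apply/allP => -[e b] dO /=.
  by apply/joinsP; exists b; rewrite tail_next // memO.
apply/setP => e; rewrite inE; apply/idP/mapP => [eC|[d dO ->]]; last exact: memO.
by have /orP[dO|dO] := tailO (e, false) eC (allO _); [exists (e, false)|exists (flip (e, false))].
Qed.

End Walk.

Lemma hamiltonian_cycleE (x0 : vert G) C :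
  hamiltonian_cycle C = [forall v, deg C v == 2] && (num_colourings C == 2).
Proof.
apply/idP/andP => [/(hamiltonian_cycle_connected_2regular x0)/andP//|[/forallP d2]].
by apply: connected_2regular_hamiltonian x0 => // v; apply/eqP.
Qed.

End Darts.

Lemma num_hamiltonian_cycles_iso (G H : mgraph) :
  isomorphic G H -> num_hamiltonian_cycles G = num_hamiltonian_cycles H.
Proof.
move=> [f [g [fB gB fg]]].
have [g' gK g'K] := gB; have [f' fK f'K] := fB.
rewrite /num_hamiltonian_cycles -(card_imset _ (imset_inj (bij_inj gB))).
apply: eq_card => D; rewrite [in RHS]inE.
have trE vs es : traces_cycle (map f vs) (map g es) = traces_cycle vs es.
  rewrite /traces_cycle size_map (map_inj_uniq (bij_inj fB)) (map_inj_uniq (bij_inj gB)).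
  do 3!congr (_ && _); rewrite -map_rot; move: (rot 1 vs) => ws.
  elim: es vs ws => [|e es IH] [|v vs] [|w ws] //=; by rewrite fg IH.
have imE s : g @: [set e in s] = [set e in map g s].
  apply/setP => e; rewrite inE; apply/imsetP/mapP => -[x xE ->]; exists x => //.
    by rewrite inE in xE.
  by rewrite inE.
apply/imsetP/hamiltonian_cycleP => [[C]|[vs [es [tr vsP ->]]]].
  rewrite inE => /hamiltonian_cycleP[vs [es [tr vsP ->]]] ->.
  exists (map f vs), (map g es); split; rewrite ?trE //.
  by move=> v; rewrite -(f'K v) map_f.
have vsE : vs = map f (map f' vs) by rewrite mapK.
have esE : es = map g (map g' es) by rewrite mapK.
exists [set e in map g' es]; last by rewrite imE -esE.
rewrite inE; apply/hamiltonian_cycleP; exists (map f' vs), (map g' es); split=> //.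
  by rewrite -trE -vsE -esE.
by move=> v; rewrite -(fK v) map_f.
Qed.

(** * Identification of vertices *)

Section GlueClass.
Variables (V : finType) (k : nat) (a b : k.-tuple V).
Local Notation class := (glue_class a b).

Lemma glue_class_const (U : Type) (h : V -> U) u v :
  (forall j, h (tnth a j) = h (tnth b j)) -> class u = class v -> h u = h v.
Proof.
move=> hab /(congr1 val)/= /eqP; rewrite (root_connect (glue_connect_sym a b)).
move=> /connectP[p]; elim: p u => [|w p IH] u /= => [_ ->//|/andP[uw pw] vE].
rewrite -(IH w pw vE) => {IH pw vE}; case/existsP: uw => j /orP[] /eqP[-> ->] //.
Qed.

Lemma glue_class_tnth j : class (tnth a j) = class (tnth b j).
Proof.
apply: val_inj; apply/eqP; rewrite /= (root_connect (glue_connect_sym a b)).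
by apply/connect1/existsP; exists j; rewrite eqxx.
Qed.

Lemma glue_class_val x : class (val x) = x.
Proof. by apply: val_inj; apply/eqP/(valP x). Qed.

Lemma glue_class_tnthP j u : uniq (a ++ b) ->
  (class u == class (tnth a j)) = (u == tnth a j) || (u == tnth b j).
Proof.
rewrite cat_uniq => /and3P[ua /hasPn ab ub].
apply/eqP/orP => [|[] /eqP ->//]; last by rewrite -glue_class_tnth.
have abN i i' : (tnth a i == tnth b i') = false.
  by apply/eqP => E; have := ab _ (mem_tnth i' b); rewrite /= -E mem_tnth.
(* The indicator of the pair respects all identifications, because the entries of [a ++ b] are
   distinct; it is therefore constant on classes. *)
pose h w := (w == tnth a j) || (w == tnth b j).
have hab i : h (tnth a i) = h (tnth b i).
  rewrite /h abN [tnth b i == tnth a j]eq_sym abN orbF.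
  by rewrite (inj_eq (tuple_uniqP _ ua)) (inj_eq (tuple_uniqP _ ub)).
by move=> /(glue_class_const hab); rewrite /h eqxx => /orP.
Qed.

(** The class map is injective on the complement of [b], since each class contains at most one
    vertex outside [b]. *)
Lemma card_glue_vert : uniq (a ++ b) -> #|V| <= #|glue_vert a b| + k.
Proof.
move=> uab; rewrite -(cardC (mem b)) addnC.
have cb : #|b| = k.
  by move: uab; rewrite cat_uniq => /and3P[_ _ /card_uniqP ->]; rewrite size_tuple.
rewrite cb leq_add2r -(card_in_imset (f := class) (D := [predC b])); first exact: max_card.
have abN j u : u \notin b -> class u = class (tnth a j) -> u = tnth a j.
  move=> ub /eqP; rewrite glue_class_tnthP // => /orP[/eqP//|/eqP uE].
  by rewrite uE mem_tnth in ub.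
move=> u v; rewrite !inE => ub vb E.
have [/tnthP[j uE]|ua] := boolP (u \in a); last exact: glue_class_inj ua ub E.
by rewrite uE in E *; rewrite (abN j v).
Qed.

Lemma card_glued_colourings (P : pred {ffun V -> bool}) :
  #|[set h : {ffun glue_vert a b -> bool} | P [ffun v => h (class v)]]| =
  #|[set h : {ffun V -> bool} | [forall j, h (tnth a j) == h (tnth b j)] && P h]|.
Proof.
pose f (h : {ffun glue_vert a b -> bool}) := [ffun v => h (class v)].
have f_inj : injective f.
  by move=> h h' /ffunP E; apply/ffunP => x; have := E (val x);
    rewrite !ffunE glue_class_val.
rewrite -(card_imset _ f_inj); apply: eq_card => h; rewrite inE.
apply/imsetP/andP => [[h' + ->]|[/forallP hab Ph]].
  by rewrite inE; split=> //; apply/forallP => j; rewrite !ffunE glue_class_tnth.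
have fE : f [ffun x => h (val x)] = h.
  apply/ffunP => v; rewrite !ffunE.
  by apply: (@glue_class_const _ h) => [j|]; [apply/eqP | rewrite glue_class_val].
by exists [ffun x => h (val x)]; rewrite ?inE -?/(f _) fE.
Qed.

End GlueClass.

Section Identify.
Variables (G : mgraph) (k : nat) (a b : k.-tuple (vert G)).
Local Notation H := (identify a b).
Local Notation class := (glue_class a b).
Implicit Type F : {set edge G}.

Lemma tail_identify (d : edge G * bool) : @tail H d = class (tail d).
Proof. by case: d => e []. Qed.

Lemma deg_identify_wall F j : uniq (a ++ b) ->
  @deg H F (class (tnth a j)) = deg F (tnth a j) + deg F (tnth b j).
Proof.
move=> uab; rewrite /deg -cardsUI [_ :&: _](_ : _ = set0) ?cards0 ?addn0.
  apply: eq_card => d; rewrite !inE tail_identify.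
  by rewrite -andb_orr glue_class_tnthP.
apply/setP => d; rewrite !inE; apply/negP => /andP[/andP[_ /eqP ->] /andP[_ /eqP E]].
move: uab; rewrite cat_uniq => /and3P[_ /hasPn /(_ _ (mem_tnth j b))].
by rewrite /= -E mem_tnth.
Qed.

Lemma deg_identify_inner F v : v \notin a -> v \notin b ->
  @deg H F (class v) = deg F v.
Proof.
move=> va vb; apply: eq_card => d; rewrite !inE tail_identify; congr (_ && _).
by apply/eqP/eqP => [/esym/(glue_class_inj va vb)|->].
Qed.

Lemma edge_invariant_identify F (h : vert H -> bool) :
  @edge_invariant H F h = edge_invariant F (fun v => h (class v)).
Proof. by []. Qed.

End Identify.

Lemma eq_edge_invariant (G : mgraph) (F : {set edge G}) (g h : vert G -> bool) :
  g =1 h -> edge_invariant F g = edge_invariant F h.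
Proof. by move=> E; apply: eq_forallb_in => e _; rewrite !E. Qed.

(** * Edge sets and colourings of disjoint unions *)

Section DisjointUnion.
Variables (G H : mgraph) (F : {set edge (disjoint_union G H)}).

Definition left_part : {set edge G} := [set e | inl e \in F].
Definition right_part : {set edge H} := [set e | inr e \in F].

Lemma deg_inl (v : vert G) : @deg (disjoint_union G H) F (inl v) = deg left_part v.
Proof.
pose f (d : edge G * bool) : edge (disjoint_union G H) * bool := (inl d.1, d.2).
have f_inj : injective f by move=> [e c] [e' c'] [-> ->].
rewrite /deg -[RHS](card_imset _ f_inj).
apply: eq_card => -[[e|e] c]; rewrite inE /tail /=.
  apply/andP/imsetP => [[eF]|[[e' c'] + [-> ->]]].
    by move=> tE; exists (e, c); rewrite ?inE //= eF; case: (c) tE.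
  by rewrite !inE /tail /= => /andP[-> tE]; case: (c') tE.
rewrite [(if c then _ else _) == _](_ : _ = false); last by case: c.
by rewrite andbF; apply/esym/imsetP => -[].
Qed.

Lemma deg_inr (v : vert H) : @deg (disjoint_union G H) F (inr v) = deg right_part v.
Proof.
pose f (d : edge H * bool) : edge (disjoint_union G H) * bool := (inr d.1, d.2).
have f_inj : injective f by move=> [e c] [e' c'] [-> ->].
rewrite /deg -[RHS](card_imset _ f_inj).
apply: eq_card => -[[e|e] c]; rewrite inE /tail /=.
  rewrite [(if c then _ else _) == _](_ : _ = false); last by case: c.
  by rewrite andbF; apply/esym/imsetP => -[].
apply/andP/imsetP => [[eF]|[[e' c'] + [-> ->]]].
  by move=> tE; exists (e, c); rewrite ?inE //= eF; case: (c) tE.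
by rewrite !inE /tail /= => /andP[-> tE]; case: (c') tE.
Qed.

Lemma edge_invariant_disjoint_union (h : vert G + vert H -> bool) :
  @edge_invariant (disjoint_union G H) F h =
  edge_invariant left_part (fun v => h (inl v)) &&
  edge_invariant right_part (fun v => h (inr v)).
Proof.
apply/forall_inP/andP => [H1|[/forall_inP H1 /forall_inP H2] [e|e] eF].
- split; apply/forall_inP => e; rewrite inE => eF; first exact: (H1 (inl e)).
  exact: (H1 (inr e)).
- by apply: H1; rewrite inE.
- by apply: H2; rewrite inE.
Qed.

End DisjointUnion.

(** Once [p x] is fixed, the conditions on [x] and [y] are independent. This serves twice for joins:
    for colourings, with [p] the restriction to the glued wall, and for edge sets, with [p] the type
    of the left part. *)
Lemma card_prod_fibration (X Y Z K : finType) (g : X * Y -> Z) (p : X -> K)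
    (P : pred Z) (Q : K -> pred X) (R : K -> pred Y) :
    bijective g -> (forall x y, P (g (x, y)) = Q (p x) x && R (p x) y) ->
  #|[set z | P z]| = \sum_c #|[set x | Q c x && (p x == c)]| * #|[set y | R c y]|.
Proof.
move=> gB PE; rewrite -sum1dep_card big_mkcond /= (reindex g) /=; last exact: onW_bij.
transitivity (\sum_x \sum_y if P (g (x, y)) then 1 else 0).
  by rewrite pair_bigA; apply: eq_bigr => -[].
rewrite (partition_big p predT) //=; apply: eq_bigr => c _.
rewrite -sum1dep_card big_distrl /= big_mkcondl /=; apply: eq_bigr => x /eqP pxc.
under eq_bigr => y _ do rewrite PE pxc.
case: (Q c x) => /=; last by rewrite big1.
by rewrite mul1n -sum1dep_card [RHS]big_mkcond.
Qed.

(** * Types of edge sets in tiles *)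

Definition restr (V : finType) k (h : V -> bool) (w : k.-tuple V) :
    {ffun 'I_k -> bool} :=
  [ffun j => h (tnth w j)].

Lemma restr_map (V W : finType) k (f : V -> W) (h : W -> bool) (w : k.-tuple V) :
  restr h (map_tuple f w) = restr (fun v => h (f v)) w.
Proof. by apply/ffunP => j; rewrite !ffunE tnth_map. Qed.

Lemma eq_restr (V : finType) k (g h : V -> bool) (w : k.-tuple V) :
  g =1 h -> restr g w = restr h w.
Proof. by move=> E; apply/ffunP => j; rewrite !ffunE. Qed.

Section EdgeSets.
Variables (k l : nat) (S : tile k l) (F : {set edge S}).

Definition wall_colourings cl cr : nat :=
  #|[set h : {ffun vert S -> bool} |
      [&& edge_invariant F h, restr h (lwall S) == cl & restr h (rwall S) == cr]]|.

Definition inner_2regular :=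
  [forall v, (v \notin lwall S) ==> (v \notin rwall S) ==> (deg F v == 2)].

End EdgeSets.

(** A colouring of the join is a pair of colourings that agree on the glued wall; sorting by the
    colours there gives a matrix product. Cyclization correspondingly takes the trace. *)
Lemma wall_colourings_join k l m (S : tile k l) (T : tile l m)
    (F : {set edge (join S T)}) cl cr :
  wall_colourings F cl cr =
  \sum_c @wall_colourings _ _ S (left_part F) cl c *
          @wall_colourings _ _ T (right_part F) c cr.
Proof.
pose P0 (h : {ffun vert S + vert T -> bool}) :=
  [&& @edge_invariant (disjoint_union S T) F h,
      restr h (map_tuple inl (lwall S)) == cl & restr h (map_tuple inr (rwall T)) == cr].
transitivity #|[set h : {ffun vert (join_graph S T) -> bool} |
                 P0 [ffun v => h (join_class v)]]|.
  apply: eq_card => h; rewrite !inE /P0 edge_invariant_identify !restr_map.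
  congr (_ && _); last (congr (_ && _); congr (_ == _)).
  - by apply: eq_edge_invariant => v; rewrite ffunE.
  - by apply: eq_restr => v; rewrite ffunE.
  - by apply: eq_restr => v; rewrite ffunE.
rewrite card_glued_colourings.
pose g (hh : {ffun vert S -> bool} * {ffun vert T -> bool}) :
    {ffun vert S + vert T -> bool} :=
  [ffun x => match x with inl v => hh.1 v | inr v => hh.2 v end].
have gB : bijective g.
  exists (fun h : {ffun vert S + vert T -> bool} =>
    ([ffun v => h (inl v)], [ffun v => h (inr v)])) => [[h1 h2]|h].
    by congr (_, _); apply/ffunP => v; rewrite !ffunE.
  by apply/ffunP => -[v|v]; rewrite !ffunE.
rewrite (@card_prod_fibration _ _ _ _ g (fun h => restr h (rwall S)) _
  (fun c (h : {ffun vert S -> bool}) =>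
     edge_invariant (left_part F) h && (restr h (lwall S) == cl))
  (fun c (h : {ffun vert T -> bool}) => [&& edge_invariant (right_part F) h,
     restr h (lwall T) == c & restr h (rwall T) == cr]) gB).
  apply: eq_bigr => c _; congr (_ * _).
  by apply: eq_card => h; rewrite !inE andbA.
move=> h1 h2; rewrite /P0 edge_invariant_disjoint_union !restr_map.
rewrite (@eq_edge_invariant _ _ _ h1) => [|v]; last by rewrite ffunE.
rewrite (@eq_edge_invariant _ _ _ h2) => [|v]; last by rewrite ffunE.
rewrite (@eq_restr _ _ _ h1) => [|v]; last by rewrite ffunE.
rewrite (@eq_restr _ _ _ h2) => [|v]; last by rewrite ffunE.
have -> : [forall j, g (h1, h2) (tnth (map_tuple inl (rwall S)) j)
               == g (h1, h2) (tnth (map_tuple inr (lwall T)) j)]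
          = (restr h2 (lwall T) == restr h1 (rwall S)).
  apply/forallP/eqP => [E|/ffunP E j].
    by apply/ffunP => j; have := E j; rewrite !tnth_map !ffunE => /eqP ->.
  by have := E j; rewrite !tnth_map !ffunE => ->.
by rewrite -!andbA; do 5!bool_congr.
Qed.

Lemma num_colourings_cyclization k (S : tile k k) (F : {set edge S}) :
  @num_colourings (cyclization S) F = \sum_c wall_colourings F c c.
Proof.
pose P0 (h : {ffun vert S -> bool}) := edge_invariant F h.
transitivity #|[set h : {ffun vert (cyclization S) -> bool} |
                 P0 [ffun v => h (glue_class (lwall S) (rwall S) v)]]|.
  apply: eq_card => h; rewrite !inE edge_invariant_identify.
  by apply: eq_edge_invariant => v; rewrite ffunE.
rewrite card_glued_colourings -sum1dep_card.
rewrite (partition_big (fun h : {ffun vert S -> bool} => restr h (lwall S)) predT) //=.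
apply: eq_bigr => c _; rewrite sum1dep_card; apply: eq_card => h; rewrite !inE.
have -> : [forall j, h (tnth (lwall S) j) == h (tnth (rwall S) j)]
          = (restr h (rwall S) == restr h (lwall S)).
  apply/forallP/eqP => [E|/ffunP E j].
    by apply/ffunP => j; have := E j; rewrite !ffunE => /eqP ->.
  by have := E j; rewrite !ffunE => ->.
rewrite /P0; case: (restr h (lwall S) =P c) => [->|]; last by rewrite !andbF.
by rewrite andbT andbC.
Qed.

Lemma tile_walls_disjoint k l (S : tile k l) v :
  v \in lwall S -> v \notin rwall S.
Proof.
have := walls_uniq S; rewrite cat_uniq => /and3P[_ /hasPn lr _] vl.
by apply/negP => /lr; rewrite /= vl.
Qed.

(** * Degrees in joins and cyclizations *)

Section JoinDegrees.
Variables (k l m : nat) (S : tile k l) (T : tile l m) (F : {set edge (join S T)}).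
Let F1 : {set edge S} := left_part F.
Let F2 : {set edge T} := right_part F.

Lemma glued_walls_uniq :
  uniq (map_tuple (@inl (vert S) (vert T)) (rwall S) ++ map_tuple inr (lwall T)).
Proof.
have := walls_uniq S; have := walls_uniq T; rewrite !cat_uniq.
move=> /and3P[uT _ _] /and3P[_ _ uS].
rewrite !map_inj_uniq ?uS ?uT ?andbT //=; try by move=> ? ? [].
by apply/hasPn => _ /mapP[v _ ->]; apply/mapP => -[].
Qed.

Lemma inl_notin_rwall v : v \notin rwall S ->
  inl v \notin map_tuple (@inl (vert S) (vert T)) (rwall S).
Proof. by rewrite mem_map // => ? ? []. Qed.

Lemma inr_notin_lwall v : v \notin lwall T ->
  inr v \notin map_tuple (@inr (vert S) (vert T)) (lwall T).
Proof. by rewrite mem_map // => ? ? []. Qed.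

Lemma inl_notin_map_inr v : inl v \notin map_tuple (@inr (vert S) (vert T)) (lwall T).
Proof. by apply/mapP => -[]. Qed.

Lemma inr_notin_map_inl v : inr v \notin map_tuple (@inl (vert S) (vert T)) (rwall S).
Proof. by apply/mapP => -[]. Qed.

Lemma deg_join_left v : v \notin rwall S ->
  @deg (join S T) F (join_class (inl v)) = deg F1 v.
Proof.
move=> vr; rewrite (@deg_identify_inner (disjoint_union S T)) ?deg_inl //.
  exact: inl_notin_rwall.
exact: inl_notin_map_inr.
Qed.

Lemma deg_join_right v : v \notin lwall T ->
  @deg (join S T) F (join_class (inr v)) = deg F2 v.
Proof.
move=> vr; rewrite (@deg_identify_inner (disjoint_union S T)) ?deg_inr //.
  exact: inr_notin_map_inl.
exact: inr_notin_lwall.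
Qed.

Lemma join_class_wall j :
  join_class (inl (tnth (rwall S) j)) = join_class (inr (tnth (lwall T) j)) :> vert (join S T).
Proof.
have := @glue_class_tnth _ _ (map_tuple (@inl (vert S) (vert T)) (rwall S))
  (map_tuple inr (lwall T)) j.
by rewrite !tnth_map.
Qed.

Lemma deg_join_wall j :
  @deg (join S T) F (join_class (inl (tnth (rwall S) j)))
  = deg F1 (tnth (rwall S) j) + deg F2 (tnth (lwall T) j).
Proof.
have := @deg_identify_wall (disjoint_union S T) _ _ _ F j glued_walls_uniq.
by rewrite !tnth_map deg_inl deg_inr.
Qed.

(** The inner vertices of the join are those of the two factors together with the glued wall, which
    misses the outer walls because the two walls of a tile are disjoint. *)
Lemma inner_2regular_join :
  inner_2regular F = [&& inner_2regular F1, inner_2regular F2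
    & [forall j, deg F1 (tnth (rwall S) j) + deg F2 (tnth (lwall T) j) == 2]].
Proof.
have inL v : v \notin rwall S ->
    (join_class (inl v) \in lwall (join S T)) = (v \in lwall S).
  move=> vr; apply/mapP/idP => [[u uS /(glue_class_inj (inl_notin_rwall vr) (inl_notin_map_inr v))[->]//]|vl].
  by exists v.
have inR v : v \notin lwall T ->
    (join_class (inr v) \in rwall (join S T)) = (v \in rwall T).
  move=> vr; apply/mapP/idP => [[u uS /(glue_class_inj (inr_notin_map_inl v) (inr_notin_lwall vr))[->]//]|vl].
  by exists v.
have LN v : v \notin rwall S -> join_class (inl v) \notin rwall (join S T).
  by move=> vr; apply/mapP => -[u _ /(glue_class_inj (inl_notin_rwall vr) (inl_notin_map_inr v))].
have RN v : v \notin lwall T -> join_class (inr v) \notin lwall (join S T).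
  by move=> vr; apply/mapP => -[u _ /(glue_class_inj (inr_notin_map_inl v) (inr_notin_lwall vr))].
have wallL j : join_class (inl (tnth (rwall S) j)) \notin lwall (join S T).
  apply/mapP => -[u uS /esym E].
  have [uE] := glue_class_inj (inl_notin_rwall (tile_walls_disjoint uS)) (inl_notin_map_inr u) E.
  by have := tile_walls_disjoint uS; rewrite uE mem_tnth.
have wallR j : join_class (inl (tnth (rwall S) j)) \notin rwall (join S T).
  rewrite join_class_wall; apply/mapP => -[u uT /esym E].
  have uN : u \notin lwall T by apply/negP => /tile_walls_disjoint; rewrite uT.
  have [uE] := glue_class_inj (inr_notin_map_inl u) (inr_notin_lwall uN) E.
  by rewrite uE mem_tnth in uN.
apply/forallP/and3P => [H|[/forallP H1 /forallP H2 /forallP H3] x].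
  split; apply/forallP => v.
  - apply/implyP => vl; apply/implyP => vr; have := H (join_class (inl v)).
    by rewrite inL // vl LN // deg_join_left.
  - apply/implyP => vl; apply/implyP => vr; have := H (join_class (inr v)).
    by rewrite inR // vr RN // deg_join_right.
  - have := H (join_class (inl (tnth (rwall S) v))).
    by rewrite wallL wallR deg_join_wall.
have wall j : deg F (join_class (inl (tnth (rwall S) j)) : vert (join S T)) == 2.
  by rewrite deg_join_wall H3.
rewrite -[x]glue_class_val -/(join_class _); case: (val x) => v.
  have [/tnthP[j ->]|vr] := boolP (v \in rwall S); first by rewrite wall !implybT.
  by rewrite inL // LN // deg_join_left //=; have := H1 v; rewrite vr.
have [/tnthP[j ->]|vl] := boolP (v \in lwall T).
  by rewrite -join_class_wall wall !implybT.
by rewrite inR // RN // deg_join_right //=; have := H2 v; rewrite vl.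
Qed.

End JoinDegrees.

Lemma cyclization_2regular k (S : tile k k) (F : {set edge S}) :
  [forall v, @deg (cyclization S) F v == 2] =
  inner_2regular F && [forall j, deg F (tnth (lwall S) j) + deg F (tnth (rwall S) j) == 2].
Proof.
apply/forallP/andP => [H|[/forallP H1 /forallP H2] x].
  split; apply/forallP => v.
    apply/implyP => vl; apply/implyP => vr.
    by rewrite -(deg_identify_inner F vl vr).
  by rewrite -(deg_identify_wall F v (walls_uniq S)).
have wall j : @deg (cyclization S) F (glue_class _ _ (tnth (lwall S) j)) == 2.
  by rewrite (deg_identify_wall F j (walls_uniq S)).
rewrite -[x]glue_class_val.
have [/tnthP[j ->]//|vl] := boolP (val x \in lwall S).
have [/tnthP[j ->]|vr] := boolP (val x \in rwall S); first by rewrite -glue_class_tnth.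
by rewrite deg_identify_inner //; have := H1 (val x); rewrite vl vr.
Qed.

(** * Capped arithmetic and types *)

Definition cap (n : nat) : 'I_4 := inord (minn n 3).

Lemma capE n : cap n = minn n 3 :> nat.
Proof. by rewrite inordK //; lia. Qed.

Lemma eq_cap m n : (cap m = cap n) <-> (minn m 3 = minn n 3).
Proof. by split=> [/(congr1 val)|E]; [|apply/val_inj]; rewrite /= !capE. Qed.

(** Capping is compatible with sums and, by [capM], with products, so capped colouring counts of a
    join are determined by those of its factors. *)
Lemma cap_sum (J : finType) (f g : J -> nat) :
  (forall j, cap (f j) = cap (g j)) -> cap (\sum_j f j) = cap (\sum_j g j).
Proof.
move=> E; elim/big_ind2: _ => // a b c d /eq_cap ab /eq_cap cd.
by apply/eq_cap; lia.
Qed.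

Lemma capM m n : cap (cap m * cap n) = cap (m * n).
Proof. by apply/eq_cap; rewrite !capE; case: m n => [|[|[|m]]] [|[|[|n]]]; nia. Qed.

Lemma cap_eq2 m n : cap m = cap n -> (m == 2) = (n == 2).
Proof. by move/eq_cap; lia. Qed.

Lemma cap_cap n : cap (cap n) = cap n.
Proof. by apply/eq_cap; rewrite capE; lia. Qed.

(* All counts are capped at 3, which makes finitely many types and still tells
   2 from other values. *)
Definition edge_type k l : finType :=
  ({ffun {ffun 'I_k -> bool} * {ffun 'I_l -> bool} -> 'I_4} *
   ({ffun 'I_k -> 'I_4} * {ffun 'I_l -> 'I_4}) * bool)%type.

Definition type_of k l (S : tile k l) (F : {set edge S}) : edge_type k l :=
  ([ffun c => cap (wall_colourings F c.1 c.2)],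
   ([ffun j => cap (deg F (tnth (lwall S) j))],
    [ffun j => cap (deg F (tnth (rwall S) j))]),
   inner_2regular F).

Definition join_type k l m (s : edge_type k l) (t : edge_type l m) : edge_type k m :=
  ([ffun c => cap (\sum_d s.1.1 (c.1, d) * t.1.1 (d, c.2))],
   (s.1.2.1, t.1.2.2),
   [&& s.2, t.2 & [forall j, s.1.2.2 j + t.1.2.1 j == 2]]).

Definition closes_up k (s : edge_type k k) : bool :=
  [&& s.2, [forall j, s.1.2.1 j + s.1.2.2 j == 2] & \sum_c s.1.1 (c, c) == 2].

Lemma type_of_join k l m (S : tile k l) (T : tile l m) (F : {set edge (join S T)}) :
  type_of F = join_type (@type_of _ _ S (left_part F)) (@type_of _ _ T (right_part F)).
Proof.
congr (_, (_, _), _).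
- apply/ffunP => c; rewrite !ffunE wall_colourings_join; apply: cap_sum => d.
  by rewrite !ffunE capM.
- apply/ffunP => j; rewrite !ffunE /join_lwall tnth_map deg_join_left //.
  by apply: tile_walls_disjoint; apply: mem_tnth.
- apply/ffunP => j; rewrite !ffunE /join_rwall tnth_map deg_join_right //.
  by apply/negP => /tile_walls_disjoint; rewrite mem_tnth.
rewrite inner_2regular_join; do 2!congr (_ && _); apply: eq_forallb => j.
(* Summands of a total of 2 lie below the cap, and a capped summand already exceeds 2. *)
by rewrite !ffunE !capE; lia.
Qed.

Lemma closes_upE k (S : tile k k) (x0 : vert S) (F : {set edge S}) :
  @hamiltonian_cycle (cyclization S) F = closes_up (type_of F).
Proof.
have y0 : vert (cyclization S) := glue_class _ _ x0.
rewrite (hamiltonian_cycleE y0) cyclization_2regular /closes_up -andbA.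
rewrite num_colourings_cyclization; congr (_ && _); congr (_ && _).
  by apply: eq_forallb => j; rewrite !ffunE !capE; lia.
by apply: cap_eq2; apply: cap_sum => c; rewrite ffunE cap_cap.
Qed.

(** * Counting by transfer matrices *)

Definition type_count k l (S : tile k l) (c : edge_type k l) : nat :=
  #|[set F : {set edge S} | type_of F == c]|.

Lemma type_count_join k l m (S : tile k l) (T : tile l m) (c : edge_type k m) :
  type_count (join S T) c =
  \sum_s #|[set F : {set edge T} | join_type s (type_of F) == c]| * type_count S s.
Proof.
pose g (FF : {set edge S} * {set edge T}) : {set edge (join S T)} :=
  [set e | match e with inl e => e \in FF.1 | inr e => e \in FF.2 end].
have gl F1 F2 : left_part (g (F1, F2)) = F1 by apply/setP => e; rewrite !inE.
have gr F1 F2 : right_part (g (F1, F2)) = F2 by apply/setP => e; rewrite !inE.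
have gB : bijective g.
  exists (fun F => (left_part F, right_part F)) => [[F1 F2]|F]; first by rewrite gl gr.
  by apply/setP => -[e|e]; rewrite !inE.
rewrite /type_count (@card_prod_fibration _ _ _ _ g (@type_of _ _ S) _
  (fun _ _ => true) (fun s F2 => join_type s (type_of F2) == c) gB).
  by apply: eq_bigr => s _; rewrite mulnC.
by move=> F1 F2; rewrite type_of_join gl gr.
Qed.

Lemma num_hamiltonian_cycles_cyclization k (S : tile k k) (x0 : vert S) :
  num_hamiltonian_cycles (cyclization S) =
  \sum_s (closes_up s : nat) * type_count S s.
Proof.
rewrite /num_hamiltonian_cycles -sum1dep_card.
rewrite (partition_big (@type_of _ _ S) predT) //=; apply: eq_bigr => s _.
rewrite sum1dep_card; case E: (closes_up s); rewrite ?mul1n ?mul0n.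
  apply: eq_card => F; rewrite !inE (closes_upE x0).
  by apply: andb_idl => /eqP ->.
apply: eq_card0 => F; rewrite !inE (closes_upE x0).
by apply/negP => /andP[+ /eqP sE]; rewrite sE E.
Qed.

(** * Numbers of vertices *)

Lemma card_vert_join k l m (S : tile k l) (T : tile l m) :
  #|vert S| + m <= #|vert (join S T)|.
Proof.
have := card_glue_vert (glued_walls_uniq S T).
rewrite [#|_|](@card_sum (vert S) (vert T)) -[#|glue_vert _ _|]/(#|vert (join S T)|).
have : l + m <= #|vert T|.
  have := max_card (mem (lwall T ++ rwall T)).
  by rewrite (card_uniqP (walls_uniq T)) size_cat !size_tuple.
lia.
Qed.

Lemma card_vert_join_seq k (S : tile k k) (Ts : seq (tile k k)) :
  #|vert S| + k * size Ts <= #|vert (join_seq S Ts)|.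
Proof.
elim: Ts S => [|T Ts IH] S /=; first by rewrite muln0 addn0.
apply: leq_trans (IH (join S T)).
by rewrite mulnS addnA leq_add2r card_vert_join.
Qed.

(** Every tile contributes at least one wall of [k] vertices that survives the gluing. For [k = 2]
    this bounds the number of tiles by the number of vertices, turning a time bound in tiles into
    one in vertices. *)
Lemma card_vert_cyclization k (S : tile k k) (Ts : seq (tile k k)) :
  k * (size Ts).+1 <= #|vert (cyclization (join_seq S Ts))|.
Proof.
have := card_glue_vert (walls_uniq (join_seq S Ts)).
have := card_vert_join_seq S Ts.
have : k + k <= #|vert S|.
  have := max_card (mem (lwall S ++ rwall S)).
  by rewrite (card_uniqP (walls_uniq S)) size_cat !size_tuple.
rewrite -[#|glue_vert _ _|]/(#|vert (cyclization (join_seq S Ts))|).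
by rewrite mulnS; lia.
Qed.

Lemma isomorphic_card_vert (G H : mgraph) : isomorphic G H -> #|vert G| = #|vert H|.
Proof. by move=> [f [g [/bij_eq_card fB _ _]]]. Qed.

Theorem theorem3 (I : finType) (T : I -> tile 2 2) (GG : mgraph -> Prop)
  (hGG : forall G : mgraph, GG G ->
     exists (i : I) (s : seq I),
       isomorphic G (cyclization (join_seq (T i) (map T s)))) :
  exists (M : machine I) (c : nat),
    forall G : mgraph, GG G ->
    forall (i : I) (s : seq I),
      isomorphic G (cyclization (join_seq (T i) (map T s))) ->
    exists t : nat,
      [/\ outputs_within M (i :: s) t (num_hamiltonian_cycles G),
          t <= c * size (i :: s) ^ 2
        & t <= c * #|vert G| ^ 2].
Proof.
pose J := edge_type 2 2.
have j0 : J := ([ffun => ord0], ([ffun => ord0], [ffun => ord0]), false).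
pose u i (j : J) := type_count (T i) j.
(* [A (Some i) j k] counts the edge sets of [T i] whose join turns type [k] into type [j]. Every row
   of [A None] is the indicator of the types that close up, so its product with the final vector is
   the answer at any index, here [j0]. *)
pose A (o : option I) (j k : J) : nat :=
  if o is Some i then #|[set F : {set edge (T i)} | join_type k (type_of F) == j]|
  else closes_up k.
(* The sum of all entries is a crude common bound for the initial vectors and the row sums; it
   depends only on the family of tiles. *)
pose B := \sum_i \sum_j u i j + \sum_o \sum_j \sum_k A o j k.
have le_sum (X : finType) (f : X -> nat) x : f x <= \sum_y f y.
  by rewrite (bigD1 x) //= leq_addr.
have u_le i j : u i j <= B.
  apply: leq_trans (leq_addr _ _); apply: leq_trans (le_sum _ _ i).
  exact: (le_sum _ (u i)).
have A_le o j : \sum_k A o j k <= B.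
  apply: leq_trans (leq_addl _ _); apply: leq_trans (le_sum _ _ o).
  exact: (le_sum _ (fun j => \sum_k A o j k)).
exists (lin_machine j0 B u A), (8 * B + 5) => G _ i s isoG.
have [t [out le_t]] := lin_machine_correct j0 u_le A_le i s.
exists t; split=> //; last first.
  apply: leq_trans le_t _; rewrite leq_mul2l leq_sqr; apply/orP; right.
  have := card_vert_cyclization (T i) (map T s).
  by rewrite -(isomorphic_card_vert isoG) size_map /=; lia.
(* The vector held by the machine after each symbol counts the edge sets of the join so far by
   type. *)
have countE r S :
    foldl (fun y i => apply_mx A (Some i) y) (finfun (@type_count 2 2 S)) r
    = finfun (type_count (join_seq S (map T r))).
  elim: r S => //= a r IH S; rewrite -IH; congr foldl; apply/ffunP => j.
  by rewrite !ffunE type_count_join; apply: eq_bigr => k _; rewrite ffunE.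
have x0 : vert (join_seq (T i) (map T s)) := tnth (lwall _) ord0.
rewrite (num_hamiltonian_cycles_iso isoG) (num_hamiltonian_cycles_cyclization x0).
move: out; rewrite countE ffunE; congr outputs_within.
by apply: eq_bigr => k _; rewrite ffunE.
Qed.
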